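(* Let $\mathbf{k}$ be a field, $X=\{x_1,\dots,x_n\}$ with $n\ge2$, $f\in\mathrm{Sym}(X)$, let $(X,r_f)$ be the corresponding permutation idempotent solution and $\mathcal{A}=\mathcal{A}(\mathbf{k},X,r_f)$ its Yang-Baxter algebra. Let $d\ge2$ be an integer and let $\mathcal{N}_d=\{w_1=x_1^d,\ w_2=x_1^{d-1}x_2,\ \dots,\ w_n=x_1^{d-1}x_n\}$ be the set of normal monomials of length $d$ ordered lexicographically. (1) The $d$-Veronese subalgebra $\mathcal{A}^{(d)}$ of $\mathcal{A}$ is a PBW algebra with set of one-generators $\mathcal{N}_d$ and standard finite presentation $$\mathcal{A}^{(d)}=\mathbf{k}\langle w_1,\dots,w_n\rangle/(\mathcal{R}_d),\qquad\mathcal{R}_d=\{w_jw_p-w_1w_p\mid2\le j\le n,\ 1\le p\le n\},$$ where $\mathcal{R}_d$ consists of $n(n-1)$ binomial relations and forms a Gröbner basis of the two-sided ideal $I=(\mathcal{R}_d)$ in $\mathbf{k}\langle w_1,\dots,w_n\rangle$. (2) The algebra $\mathcal{A}$ and its Veronese subalgebra $\mathcal{A}^{(d)}$ are isomorphic.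
   Context: The permutation idempotent solution is $r_f(x,y)=(f(y),y)$ on $X\times X$, and its Yang-Baxter algebra is $\mathcal{A}(\mathbf{k},X,r_f)=\mathbf{k}\langle X\rangle/(xy-f(y)y\mid x,y\in X)$, where $\mathbf{k}\langle X\rangle$ is the free unital associative algebra on $X$; it is graded by word length. Normal monomials are taken with respect to the degree-lexicographic order with $x_1<\dots<x_n$: a word is normal if it contains no leading monomial of a nonzero element of the ideal of relations as a subword; each $w\in\mathcal{N}_d$ is viewed as an element of $\mathcal{A}_d$. For a graded algebra $A=\bigoplus_{m\ge0}A_m$ and $d\ge2$, the $d$-Veronese subalgebra is $A^{(d)}=\bigoplus_{m\ge0}A_{md}$, graded by $(A^{(d)})_m=A_{md}$. Gröbner bases in $\mathbf{k}\langle w_1,\dots,w_n\rangle$ are with respect to the degree-lexicographic order with $w_1<\dots<w_n$. An algebra $\mathbf{k}\langle w_1,\dots,w_n\rangle/I$ is PBW with PBW-generators $w_1,\dots,w_n$ if $I$ has a Gröbner basis of homogeneous quadratic polynomials. *)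

(* Defs.v *)
From HB Require Import structures.
From mathcomp Require Import all_boot all_order all_fingroup all_algebra.
From mathcomp Require Import generic_quotient ring_quotient finmap.
From mathcomp Require Import boolp classical_sets cardinality.
From mathcomp.multinomials Require Import monalg.

Set Implicit Arguments.
Unset Strict Implicit.
Unset Printing Implicit Defensive.

Import GRing.Theory.
Local Open Scope classical_set_scope.
Local Open Scope ring_scope.
Local Open Scope quotient_scope.

(* k<x_1, ..., x_n> is the monoid algebra of the free monoid on 'I_n;
   the ordinal i stands for x_(i+1). *)
Notation freealg k n := {malg k[{fmonom 'I_n}]}.

Section Words.
Variables (k : fieldType) (n : nat).
Implicit Types (p g : freealg k n) (w u v : {fmonom 'I_n}).

Definition mword (s : seq 'I_n) : freealg k n := << FMonom s >>.

Definition xgen (i : 'I_n) : freealg k n := mword [:: i].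

Definition lexle (s t : seq 'I_n) : bool :=
  ((s : seqlexi 'I_n) <= (t : seqlexi 'I_n))%O.

Definition deglexle (s t : seq 'I_n) : bool :=
  (size s < size t)%N || (size s == size t) && lexle s t.

(* In particular p != 0. *)
Definition lead_word p w : Prop :=
  w \in msupp p /\ forall v, v \in msupp p -> deglexle v w.

Definition homog (m : nat) : set (freealg k n) :=
  [set p | forall w, w \in msupp p -> size w = m].

Definition is_binomial p : Prop :=
  exists s t : seq 'I_n, s != t /\ p = mword s - mword t.

Definition ideal (S : set (freealg k n)) : set (freealg k n) :=
  [set p | exists s : seq (freealg k n * freealg k n * freealg k n),
     (forall t, t \in s -> S t.1.2) /\
     p = \sum_(t <- s) t.1.1 * t.1.2 * t.2].

Definition normal_word (I : set (freealg k n)) (s : seq 'I_n) : Prop :=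
  forall p u, I p -> lead_word p u -> ~~ infix u s.

Definition groebner_basis (I G : set (freealg k n)) : Prop :=
  ideal G = I /\
  forall p w, I p -> lead_word p w ->
    exists g u, [/\ G g, lead_word g u & infix u w].

Record quadratic_rels := QuadraticRels {
  qrels :> set (freealg k n);
  qrelsP : qrels `<=` homog 2 }.

End Words.

Arguments mword {k n} s.
Arguments xgen {k n} i.
Arguments homog {k n} m.

Section HomogeneousComponents.
Variables (k : fieldType) (n : nat).
Implicit Types (p q : freealg k n) (w u v : {fmonom 'I_n}).

Definition hcomp m p : freealg k n :=
  [malg w in msupp p => if size w == m then p@_w else 0].

Lemma hcompE m p w : (hcomp m p)@_w = if size w == m then p@_w else 0.
Proof.
rewrite /hcomp mcoeffE; case: ifP => // /negbT /mcoeff_outdom ->.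
by case: ifP.
Qed.

Lemma hcomp_is_additive m : zmod_morphism (hcomp m).
Proof.
move=> p q; apply/malgP=> w; rewrite mcoeffB !hcompE mcoeffB.
by case: ifP; rewrite // subr0.
Qed.

HB.instance Definition _ m :=
  GRing.isZmodMorphism.Build (freealg k n) (freealg k n) (hcomp m)
    (hcomp_is_additive m).

Lemma homogP m p : homog m p <-> forall w, size w != m -> p@_w = 0.
Proof.
split=> [hp w sw|hp w].
  by apply: mcoeff_outdom; apply: contra sw => /hp ->.
by rewrite -mcoeff_neq0 => pw; apply/eqP; apply: contraNT pw => /hp ->.
Qed.

Lemma homog_hcomp m p : homog m (hcomp m p).
Proof. by apply/homogP => w /negbTE sw; rewrite hcompE sw. Qed.

Lemma hcomp_homog m m' p : homog m p -> hcomp m' p = if m == m' then p else 0.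
Proof.
move=> /homogP hp; apply/malgP => w; rewrite hcompE.
case: (eqVneq (size w) m') => [sw|sw]; case: (eqVneq m m') => [e|e] //.
- by rewrite mcoeff0 hp // sw eq_sym.
- by rewrite hp ?e.
- by rewrite mcoeff0.
Qed.

Lemma homogD m (c : k) p q : homog m p -> homog m q -> homog m (c *: p + q).
Proof.
move=> /homogP hp /homogP hq; apply/homogP => w sw.
by rewrite mcoeffD mcoeffZ hp // hq // mulr0 addr0.
Qed.

Lemma homog0 m : homog m (0 : freealg k n).
Proof. by apply/homogP => w _; rewrite mcoeff0. Qed.

Lemma homogM m m' p q : homog m p -> homog m' q -> homog (m + m') (p * q).
Proof.
move=> hp hq w /msuppM_le [u [v [/hp su /hq sv ->]]].
by rewrite fmM size_cat su sv.
Qed.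

Lemma homogU (c : k) w : homog (size w) << c *g w >>.
Proof.
by move=> v /(fsubsetP (@msuppU_le _ _ _ _)); rewrite in_fset1 => /eqP ->.
Qed.

Lemma homog1 : homog 0 (1 : freealg k n).
Proof.
apply/homogP => w sw; rewrite mcoeff1; case: eqP => // w1.
by rewrite w1 fm1 in sw.
Qed.

Lemma hcomp_sum p : exists N, p = \sum_(m < N) hcomp m p.
Proof.
exists (\max_(w <- msupp p) size w).+1; apply/malgP => w.
rewrite raddf_sum /=; under eq_bigr do rewrite hcompE.
case: msuppP => [wp|/mcoeff_outdom pw]; last first.
  by rewrite big1 // => i _; case: ifP.
have sw : (size w < (\max_(w <- msupp p) size w).+1)%N.
  rewrite ltnS.
  exact: (@leq_bigmax_seq _ _ xpredT (fun w : {fmonom 'I_n} => size w)).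
rewrite (bigD1 (Ordinal sw)) //= eqxx big1 ?addr0 // => i.
by rewrite -val_eqE /= eq_sym => /negbTE ->.
Qed.

End HomogeneousComponents.

Arguments homogU {k n} c w.
Arguments homog0 {k n} m.
Arguments homog1 {k n}.

Section Ideal.
Variables (k : fieldType) (n : nat).
Implicit Types (S : set (freealg k n)) (p q : freealg k n).

Lemma ideal0 S : ideal S 0.
Proof. by exists [::]; rewrite big_nil. Qed.

Lemma idealD S p q : ideal S p -> ideal S q -> ideal S (p + q).
Proof.
move=> [s [Ss ->]] [t [St ->]]; exists (s ++ t); rewrite big_cat; split=> // x.
by rewrite mem_cat => /orP[/Ss|/St].
Qed.

Lemma idealMl S a p : ideal S p -> ideal S (a * p).
Proof.
move=> [s [Ss ->]]; exists [seq (a * t.1.1, t.1.2, t.2) | t <- s]; split.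
  by move=> _ /mapP[t /Ss St ->].
by rewrite big_map mulr_sumr; apply: eq_bigr => t _; rewrite /= !mulrA.
Qed.

Lemma idealMr S a p : ideal S p -> ideal S (p * a).
Proof.
move=> [s [Ss ->]]; exists [seq (t.1.1, t.1.2, t.2 * a) | t <- s]; split.
  by move=> _ /mapP[t /Ss St ->].
rewrite big_map [LHS]mulr_suml; apply: eq_bigr => t _ /=.
exact: esym (mulrA _ _ _).
Qed.

Lemma idealB S p q : ideal S p -> ideal S q -> ideal S (p - q).
Proof. by move=> Ip Iq; rewrite -mulN1r; apply: idealD => //; apply: idealMl. Qed.

Lemma idealZ S (c : k) p : ideal S p -> ideal S (c *: p).
Proof. by rewrite -mul_malgC; apply: idealMl. Qed.

Lemma ideal_gen S a r b : S r -> ideal S (a * r * b).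
Proof.
by exists [:: (a, r, b)]; rewrite big_seq1; split=> // t; rewrite inE => /eqP ->.
Qed.

Lemma ideal_sum S I (r : seq I) (P : pred I) (F : I -> freealg k n) :
  (forall i, P i -> ideal S (F i)) -> ideal S (\sum_(i <- r | P i) F i).
Proof. by move=> IF; apply: big_ind => //; [apply: ideal0 | apply: idealD]. Qed.

Lemma hcomp_ideal (S : quadratic_rels k n) m p :
  ideal S p -> ideal S (hcomp m p).
Proof.
move=> [s [Ss ->]]; rewrite raddf_sum big_seq /=; apply: ideal_sum => t /Ss.
move: t => [[a r] b] /= Sr.
rewrite [a]monalgE [b]monalgE -mulrA mulr_suml raddf_sum /=.
apply: ideal_sum => u _; rewrite mulrA mulr_sumr raddf_sum /=.
apply: ideal_sum => v _.
have hur := @homogM _ _ _ _ _ _ (homogU (a@_u) u) (qrelsP Sr).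
rewrite (hcomp_homog _ (@homogM _ _ _ _ _ _ hur (homogU (b@_v) v))); case: ifP => _; last exact: ideal0.
exact: ideal_gen.
Qed.

Lemma ideal_proper (S : quadratic_rels k n) : ~ ideal S 1.
Proof.
move=> [s [Ss e]]; have := oner_neq0 k.
rewrite -(rmorph1 (mcoeff (mone : {fmonom 'I_n}) : freealg k n -> k)) e.
rewrite raddf_sum big_seq big1 ?eqxx //= => t /Ss /qrelsP /homogP h.
by rewrite !rmorphM /= h ?fm1 // mulr0 mul0r.
Qed.

End Ideal.

Section QuadraticAlgebra.
Variables (k : fieldType) (n : nat) (S : quadratic_rels k n).
Local Notation F := (freealg k n).

Definition ideal_pred : {pred F} := fun p => `[< ideal S p >].

Lemma ideal_predE p : (p \in ideal_pred) = `[< ideal S p >].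
Proof. by []. Qed.

Lemma ideal_pred_zmod_closed : zmod_closed ideal_pred.
Proof.
split=> [|p q /asboolP Ip /asboolP Iq]; apply/asboolP; first exact: ideal0.
exact: idealB.
Qed.

HB.instance Definition _ :=
  GRing.isZmodClosed.Build F ideal_pred ideal_pred_zmod_closed.

(* Over a noncommutative ring, mathcomp only provides the additive structure
   of the quotient; its algebra structure is added below. *)
Definition quadalg := Quotient.quot (GRing.ZmodClosed.clone _ ideal_pred _).

HB.instance Definition _ := GRing.Zmodule.on quadalg.

Definition quadpi (p : F) : quadalg := \pi_quadalg p.

HB.instance Definition _ := GRing.Additive.copy quadpi \pi_quadalg.

Lemma quadpiK (a : quadalg) : quadpi (repr a) = a.
Proof. exact: reprK. Qed.

Lemma quadpi_eq p q : quadpi p = quadpi q <-> ideal S (p - q).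
Proof.
split=> [/eqP|Ipq]; first by rewrite -Quotient.idealrBE => /asboolP.
by apply/eqP; rewrite -Quotient.idealrBE; apply/asboolP.
Qed.

Lemma ideal_repr p : ideal S (repr (quadpi p) - p).
Proof. by apply/quadpi_eq; rewrite quadpiK. Qed.

Definition qmul (a b : quadalg) : quadalg := quadpi (repr a * repr b).
Definition qscale (c : k) (a : quadalg) : quadalg := quadpi (c *: repr a).

Lemma quadpi_mul p q : qmul (quadpi p) (quadpi q) = quadpi (p * q).
Proof.
apply/quadpi_eq; set p' := repr _; set q' := repr _.
have -> : p' * q' - p * q = (p' - p) * q' + p * (q' - q).
  by rewrite mulrBl mulrBr addrA subrK.
by apply: idealD; [apply: idealMr | apply: idealMl]; apply: ideal_repr.
Qed.

Lemma quadpi_scale c p : qscale c (quadpi p) = quadpi (c *: p).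
Proof.
by apply/quadpi_eq; rewrite -scalerBr; apply: idealZ; apply: ideal_repr.
Qed.

Lemma qmulA : associative qmul.
Proof.
move=> a b c; rewrite -[a]quadpiK -[b]quadpiK -[c]quadpiK.
by rewrite !quadpi_mul mulrA.
Qed.

Lemma qmul1 : left_id (quadpi 1) qmul.
Proof. by move=> a; rewrite -[a]quadpiK quadpi_mul mul1r. Qed.

Lemma qmulr1 : right_id (quadpi 1) qmul.
Proof. by move=> a; rewrite -[a]quadpiK quadpi_mul mulr1. Qed.

Lemma qmulDl : left_distributive qmul +%R.
Proof.
move=> a b c; rewrite -[a]quadpiK -[b]quadpiK -[c]quadpiK.
by rewrite -raddfD !quadpi_mul mulrDl raddfD.
Qed.

Lemma qmulDr : right_distributive qmul +%R.
Proof.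
move=> a b c; rewrite -[a]quadpiK -[b]quadpiK -[c]quadpiK.
by rewrite -raddfD !quadpi_mul mulrDr raddfD.
Qed.

Lemma quadpi1_neq0 : quadpi 1 != 0.
Proof.
apply/eqP; rewrite -(raddf0 quadpi) => /quadpi_eq; rewrite subr0.
exact: ideal_proper.
Qed.

HB.instance Definition _ := GRing.Zmodule_isNzRing.Build quadalg
  qmulA qmul1 qmulr1 qmulDl qmulDr quadpi1_neq0.

Lemma qscaleA c c' a : qscale c (qscale c' a) = qscale (c * c') a.
Proof. by rewrite -[a]quadpiK !quadpi_scale scalerA. Qed.

Lemma qscale1 : left_id 1 qscale.
Proof. by move=> a; rewrite -[a]quadpiK quadpi_scale scale1r. Qed.

Lemma qscaleDr : right_distributive qscale +%R.
Proof.
move=> c a b; rewrite -[a]quadpiK -[b]quadpiK.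
by rewrite -raddfD !quadpi_scale scalerDr raddfD.
Qed.

Lemma qscaleDl a : {morph qscale^~ a : c c' / c + c'}.
Proof.
by move=> c c'; rewrite -[a]quadpiK !quadpi_scale scalerDl raddfD.
Qed.

HB.instance Definition _ := GRing.Zmodule_isLmodule.Build k quadalg
  qscaleA qscale1 qscaleDr qscaleDl.

Lemma quadpi_is_monoid_morphism : monoid_morphism quadpi.
Proof. by split=> [|p q]; [|exact/esym/quadpi_mul]. Qed.

HB.instance Definition _ := GRing.isMonoidMorphism.Build F quadalg quadpi
  quadpi_is_monoid_morphism.

Lemma quadpi_is_scalable : scalable quadpi.
Proof. by move=> c p; rewrite -quadpi_scale. Qed.

HB.instance Definition _ := GRing.isScalable.Build k F quadalg *:%R quadpi
  quadpi_is_scalable.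

Lemma qscaleAl (c : k) (a b : quadalg) : c *: (a * b) = (c *: a) * b.
Proof.
rewrite -[a]quadpiK -[b]quadpiK.
by rewrite -rmorphM -!linearZ -rmorphM /= scalerAl.
Qed.

HB.instance Definition _ := GRing.Lmodule_isLalgebra.Build k quadalg qscaleAl.

Lemma malg_scaleAr (c : k) (p q : F) : c *: (p * q) = p * (c *: q).
Proof.
apply/malgP => w; rewrite mcoeffZ [in LHS](mcoeffMlw _ (fsubset_refl _) (fsubset_refl _)).
rewrite [RHS](mcoeffMlw _ (fsubset_refl _) (msuppZ_le c q)) mulr_sumr.
apply: eq_bigr => u _; rewrite mulr_sumr; apply: eq_bigr => v _.
by rewrite mcoeffZ mulrnAr mulrCA.
Qed.

Lemma qscaleAr (c : k) (a b : quadalg) : c *: (a * b) = a * (c *: b).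
Proof.
rewrite -[a]quadpiK -[b]quadpiK.
by rewrite -rmorphM -!linearZ -rmorphM /= malg_scaleAr.
Qed.

HB.instance Definition _ := GRing.Lalgebra_isAlgebra.Build k quadalg qscaleAr.

End QuadraticAlgebra.

Arguments quadpi {k n} S p.

Record grading (k : fieldType) (A : algType k) := Grading {
  gpart :> nat -> set A;
  gpart0 : forall m, gpart m 0;
  gpartD : forall m (c : k) a b, gpart m a -> gpart m b -> gpart m (c *: a + b);
  gpart1 : gpart 0 1;
  gpartM : forall i j a b, gpart i a -> gpart j b -> gpart (i + j)%N (a * b);
  gpart_span : forall a, exists (N : nat) (c : nat -> A),
    (forall m, gpart m (c m)) /\ a = \sum_(m < N) c m;
  gpart_direct : forall (N : nat) (c : nat -> A), (forall m, gpart m (c m)) ->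
    \sum_(m < N) c m = 0 -> forall m, (m < N)%N -> c m = 0 }.

Section LengthGrading.
Variables (k : fieldType) (n : nat) (S : quadratic_rels k n).
Local Notation A := (quadalg S).

Definition length_part (m : nat) : set A := quadpi S @` homog m.

Lemma length_part0 m : length_part m 0.
Proof. by exists 0; [apply: homog0 | rewrite raddf0]. Qed.

Lemma length_partD m (c : k) a b :
  length_part m a -> length_part m b -> length_part m (c *: a + b).
Proof.
move=> [p hp <-] [q hq <-]; exists (c *: p + q); first exact: homogD.
by rewrite linearP.
Qed.

Lemma length_part1 : length_part 0 1.
Proof. by exists 1; [apply: homog1 | rewrite rmorph1]. Qed.

Lemma length_partM i j a b :
  length_part i a -> length_part j b -> length_part (i + j) (a * b).
Proof.
move=> [p hp <-] [q hq <-]; exists (p * q); first exact: homogM.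
by rewrite rmorphM.
Qed.

Lemma length_part_span (a : A) : exists (N : nat) (c : nat -> A),
  (forall m, length_part m (c m)) /\ a = \sum_(m < N) c m.
Proof.
have [N e] := hcomp_sum (repr a).
exists N, (fun m => quadpi S (hcomp m (repr a))); split=> [m|].
  by exists (hcomp m (repr a)); [apply: homog_hcomp |].
by rewrite -[LHS]quadpiK {1}e raddf_sum.
Qed.

Lemma length_part_direct (N : nat) (c : nat -> A) :
  (forall m, length_part m (c m)) -> \sum_(m < N) c m = 0 ->
  forall m, (m < N)%N -> c m = 0.
Proof.
move=> hc s0 m ltmN.
have /choice[p hp] : forall i, exists p, homog i p /\ quadpi S p = c i.
  by move=> i; have [p] := hc i; exists p.
have Is : ideal S (\sum_(i < N) p i).
  rewrite -[X in ideal S X]subr0; apply/quadpi_eq; rewrite raddf0 -[RHS]s0 raddf_sum.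
  by apply: eq_bigr => i _; exact: (hp i).2.
have := hcomp_ideal m Is; rewrite raddf_sum /= (bigD1 (Ordinal ltmN)) //=.
rewrite big1 ?addr0 => [|i].
  rewrite (hcomp_homog _ (hp m).1) eqxx -[X in ideal S X]subr0.
  by move/quadpi_eq; rewrite raddf0 (hp m).2.
by rewrite -val_eqE /= => /negbTE im; rewrite (hcomp_homog _ (hp i).1) im.
Qed.

Definition length_grading : grading A :=
  Grading length_part0 length_partD length_part1 length_partM
    length_part_span length_part_direct.

End LengthGrading.

Section Veronese.
Variables (k : fieldType) (A : algType k) (G : grading A) (d : nat).

(* The sum of the A_(md), realized inside A as a subalgebra. *)
Definition veronese_set : set A :=
  [set a | exists (N : nat) (c : nat -> A),
     (forall m, G (m * d)%N (c m)) /\ a = \sum_(m < N) c m].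

Definition veronese_pred : {pred A} := fun a => `[< veronese_set a >].

Lemma gpart_sum m I (r : seq I) (P : pred I) (F : I -> A) :
  (forall i, P i -> G m (F i)) -> G m (\sum_(i <- r | P i) F i).
Proof.
move=> GF; apply: big_ind => //; first exact: gpart0.
by move=> a b Ga Gb; rewrite -[a]scale1r; apply: gpartD.
Qed.

Lemma veronese_part m a : G (m * d)%N a -> veronese_set a.
Proof.
move=> Ga; exists m.+1, (fun i => if i == m then a else 0); split=> [i|].
  by case: eqP => [->|_] //; apply: gpart0.
by rewrite big_ord_recr /= eqxx big1 ?add0r // => i _; rewrite ltn_eqF.
Qed.

Lemma veronese0 : veronese_set 0.
Proof. by apply: (@veronese_part 0); apply: gpart0. Qed.

Lemma veroneseZ (c : k) a : veronese_set a -> veronese_set (c *: a).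
Proof.
move=> [N [u [Gu ->]]]; exists N, (fun m => c *: u m); split=> [m|].
  by rewrite -[_ *: _]addr0; apply: gpartD => //; apply: gpart0.
by rewrite scaler_sumr.
Qed.

Lemma veroneseD a b : veronese_set a -> veronese_set b -> veronese_set (a + b).
Proof.
move=> [N [u [Gu ->]]] [M [v [Gv ->]]].
pose cut L (w : nat -> A) m := if (m < L)%N then w m else 0.
have cutG L w m : (forall m, G (m * d)%N (w m)) -> G (m * d)%N (cut L w m).
  by move=> Gw; rewrite /cut; case: ifP => // _; apply: gpart0.
have cutE L K w : (L <= K)%N -> \sum_(m < K) cut L w m = \sum_(m < L) w m.
  by move=> leLK; rewrite (big_ord_widen K w leLK) [RHS]big_mkcond.
exists (maxn N M), (fun m => cut N u m + cut M v m); split=> [m|].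
  by rewrite -[cut N u m]scale1r; apply: gpartD; apply: cutG.
by rewrite big_split /= !cutE ?leq_maxl ?leq_maxr.
Qed.

Lemma veronese_sum I (r : seq I) (P : pred I) (F : I -> A) :
  (forall i, P i -> veronese_set (F i)) ->
  veronese_set (\sum_(i <- r | P i) F i).
Proof.
by move=> VF; apply: big_ind => //; [apply: veronese0 | apply: veroneseD].
Qed.

Lemma veroneseM a b : veronese_set a -> veronese_set b -> veronese_set (a * b).
Proof.
move=> [N [u [Gu ->]]] [M [v [Gv ->]]]; rewrite mulr_suml.
apply: veronese_sum => i _; rewrite mulr_sumr; apply: veronese_sum => j _.
by apply: (@veronese_part (i + j)); rewrite mulnDl; apply: gpartM.
Qed.

Lemma veronese_subalg_closed : GRing.subsemialg_closed veronese_pred.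
Proof.
split.
- by apply/asboolP; apply: (@veronese_part 0); apply: gpart1.
- split=> [|a b /asboolP Va /asboolP Vb]; apply/asboolP; first exact: veronese0.
  exact: veroneseD.
- by move=> c a /asboolP Va; apply/asboolP; apply: veroneseZ.
- by move=> a b /asboolP Va /asboolP Vb; apply/asboolP; apply: veroneseM.
Qed.

HB.instance Definition _ :=
  GRing.isSubalgClosed.Build k A veronese_pred veronese_subalg_closed.

Record veronese := Veronese {
  veronese_val :> A;
  veroneseP : veronese_val \in veronese_pred }.

HB.instance Definition _ := [isSub for veronese_val].
HB.instance Definition _ := [Choice of veronese by <:].
HB.instance Definition _ := [SubChoice_isSubAlgebra of veronese by <:].

Definition veronese_gpart (m : nat) : set veronese :=
  [set a | G (m * d)%N (val a)].

End Veronese.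

Section Presentations.
Variables (k : fieldType) (n : nat).

(* B, graded by P, is k<x_1, ..., x_n>/(S) with x_i corresponding to b_i. *)
Definition presentation (S : quadratic_rels k n) (B : algType k)
    (P : nat -> set B) (b : 'I_n -> B) : Prop :=
  exists phi : {lrmorphism quadalg S -> B},
    [/\ bijective phi,
        forall i, phi (quadpi S (xgen i)) = b i &
        forall m a, length_part m a <-> P m (phi a)].

(* Since a Groebner basis generates its ideal, the ideal of relations is the
   one generated by the quadratic Groebner basis S. *)
Definition PBW_algebra (B : algType k) (P : nat -> set B) (b : 'I_n -> B) :=
  exists S : quadratic_rels k n,
    groebner_basis (ideal S) S /\ presentation S P b.

Definition one_generators (B : algType k) (P : nat -> set B) (b : 'I_n -> B) :=
  [/\ P 1%N = range (fun c : {ffun 'I_n -> k} => \sum_i c i *: b i),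
      injective (fun c : {ffun 'I_n -> k} => \sum_i c i *: b i) &
      forall V : {pred B}, GRing.subalg_closed V ->
        (forall i, b i \in V) -> forall a, a \in V].

End Presentations.

Section YangBaxterAlgebra.
Variables (k : fieldType) (n : nat).

Definition YB_rels_set (r : 'I_n * 'I_n -> 'I_n * 'I_n) : set (freealg k n) :=
  [set g | exists x y : 'I_n,
     g = xgen x * xgen y - xgen (r (x, y)).1 * xgen (r (x, y)).2].

Lemma homog_gen2 (x y x' y' : 'I_n) :
  homog 2 (xgen x * xgen y - xgen x' * xgen y' : freealg k n).
Proof.
have h (i j : 'I_n) : homog 2 (xgen i * xgen j : freealg k n).
  by apply: (@homogM _ _ 1 1); apply: homogU.
by rewrite addrC -scaleN1r; apply: homogD.
Qed.

Lemma YB_rels_homog r : YB_rels_set r `<=` homog 2.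
Proof. by move=> _ [x [y ->]]; apply: homog_gen2. Qed.

Definition YB_rels r := QuadraticRels (@YB_rels_homog r).

Definition YB_algebra r := quadalg (YB_rels r).

Definition YB_grading r : grading (YB_algebra r) := length_grading (YB_rels r).

Definition perm_idem_sol (f : {perm 'I_n}) (xy : 'I_n * 'I_n) : 'I_n * 'I_n :=
  (f xy.2, xy.2).

(* The generators stand here for w_1, ..., w_n, and i1 for the index of w_1. *)
Definition veronese_rels_set (i1 : 'I_n) : set (freealg k n) :=
  [set g | exists j p : 'I_n,
     j != i1 /\ g = xgen j * xgen p - xgen i1 * xgen p].

Lemma veronese_rels_homog i1 : veronese_rels_set i1 `<=` homog 2.
Proof. by move=> _ [j [p [_ ->]]]; apply: homog_gen2. Qed.

Definition veronese_rels i1 := QuadraticRels (@veronese_rels_homog i1).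

End YangBaxterAlgebra.

(* Main.v *)
Require Import Defs.
From HB Require Import structures.
From mathcomp Require Import all_boot all_order all_fingroup all_algebra.
From mathcomp Require Import generic_quotient finmap.
From mathcomp Require Import boolp classical_sets cardinality.
From mathcomp.multinomials Require Import monalg.

Set Implicit Arguments.
Unset Strict Implicit.
Unset Printing Implicit Defensive.

Import GRing.Theory.
Local Open Scope classical_set_scope.
Local Open Scope ring_scope.

(** In the algebra of perm_idem_sol f, the relations x y = f(y) y hold for every
    letter x, so a letter followed by y may be replaced by any other one.  Hence
    the ideal of relations does not depend on f: it is generated by the
    differences x y - x_1 y, that is, by the veronese_rels themselves.

    Replacing letters until only x_1 is left in front of the last letter sends
    a word s to the word nf s = x_1^(m-1) y, where m is the length and y the
    last letter of s.  Let reduce be the linear extension of nf.  Since nf s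
    depends on s only through its length and its last letter, reducing the
    factors of a product before multiplying them does not change the reduction
    of the product; so the kernel of reduce is an ideal, and it is the ideal of
    relations (ideal_reduce, YB_ideal, veronese_ideal).  As x_1 is the smallest
    letter, nf s is at most s in the degree-lexicographic order.  Therefore the
    leading word of an element of the ideal is never fixed by nf
    (lead_word_reducible).  A word is not fixed by nf exactly when it contains
    a factor x_j x_p with j <> 1 (nf_fixedP), which is the leading word of a
    relation.  This gives both the normal words and the Groebner basis.

    In the Veronese subalgebra, w_i w_j = x_1^(d-1) x_i x_1^(d-1) x_j
    = x_1^(2d-1) x_j also depends on the first factor only through its length,
    so x_i |-> w_i extends to a morphism from the algebra to its Veronese
    subalgebra.  On words it is given, up to reduction, by stretch, which
    multiplies the length by d and keeps the last letter; contract divides the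
    length by d and keeps the last letter.  These two operations are inverse to
    each other up to nf, so the morphism is a graded bijection
    (veronese_presentation).  Since both families of relations generate the same
    ideal, the source can be read as the algebra presented by veronese_rels,
    for the presentation, or as the Yang-Baxter algebra, for the isomorphism of
    the algebra with its Veronese subalgebra. *)

(** * Linear maps and algebra morphisms defined on words *)

Section LinearExtension.
Variables (k : fieldType) (n : nat).
Local Notation F := (freealg k n).
Implicit Types (p q : F) (s t : seq 'I_n) (h : seq 'I_n -> seq 'I_n).

Lemma mwordU (c : k) (w : {fmonom 'I_n}) : << c *g w >> = c *: mword w.
Proof. by apply/malgP => v; rewrite mcoeffZ !mcoeffU mulrnAr mulr1 fmK. Qed.

Lemma mword_nil : mword [::] = 1 :> F.
Proof. by rewrite /mword -fmoneE. Qed.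

Lemma mword_cat s t : mword (s ++ t) = mword s * mword t :> F.
Proof. by rewrite /mword malgM_def fgmulUU mulr1 [mmul _ _]fmmulE. Qed.

Lemma mword_cons i s : mword (i :: s) = xgen i * mword s :> F.
Proof. exact: (mword_cat [:: i]). Qed.

Lemma mword2 i j : xgen i * xgen j = mword [:: i; j] :> F.
Proof. by rewrite mword_cons. Qed.

Lemma mwordE p : p = \sum_(w <- msupp p) p@_w *: mword w :> F.
Proof. by rewrite {1}[p]monalgE; apply: eq_bigr => w _; rewrite mwordU. Qed.

(** Linear induction from the words.  There is no case for 0, since it is the
    linear combination -1 *: 1 + 1 of empty words. *)
Lemma mword_ind (P : F -> Prop) : (forall s, P (mword s)) ->
  (forall c p q, P p -> P q -> P (c *: p + q)) -> forall p, P p.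
Proof.
move=> Pw PD p.
have P0 : P 0 by rewrite -(addNr (mword [::])) -scaleN1r; apply: PD; apply: Pw.
rewrite [p]mwordE.
elim: (enum_fset _) => [|w s IH]; rewrite ?big_nil // big_cons.
by apply: PD.
Qed.

Definition word_lin (V : lmodType k) (h : seq 'I_n -> V) (p : F) : V :=
  \sum_(w <- msupp p) p@_w *: h w.

Section WordLin.
Variables (V : lmodType k) (h : seq 'I_n -> V).

Lemma word_linEw (D : {fset {fmonom 'I_n}}) p : (msupp p `<=` D)%fset ->
  word_lin h p = \sum_(w <- D) p@_w *: h w.
Proof.
move=> le; rewrite [LHS](big_fset_incl _ le) => //= x xd /mcoeff_outdom ->.
by rewrite scale0r.
Qed.

Lemma word_lin_is_linear : linear (word_lin h).
Proof.
move=> c p q; pose D := (msupp p `|` msupp q)%fset.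
have pD : (msupp p `<=` D)%fset by apply: fsubsetUl.
have qD : (msupp q `<=` D)%fset by apply: fsubsetUr.
rewrite (word_linEw pD) (word_linEw qD) (@word_linEw D); last first.
  apply: fsubset_trans (msuppD_le _ _) _; rewrite fsubUset qD andbT.
  exact: fsubset_trans (msuppZ_le _ _) pD.
rewrite scaler_sumr -big_split /=; apply: eq_bigr => w _.
by rewrite mcoeffD mcoeffZ scalerDl scalerA.
Qed.

HB.instance Definition _ :=
  GRing.isLinear.Build k F V *:%R (word_lin h) word_lin_is_linear.

Lemma word_lin_mword s : word_lin h (mword s) = h s.
Proof.
rewrite (word_linEw (D := [fset FMonom s]%fset)) ?msuppU_le //.
by rewrite big_seq_fset1 mcoeffUU scale1r.
Qed.

End WordLin.

Definition word_map (h : seq 'I_n -> seq 'I_n) : F -> F :=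
  word_lin (fun s => mword (h s)).

HB.instance Definition _ h := GRing.Linear.on (word_map h).

Lemma word_map_mword h s : word_map h (mword s) = mword (h s).
Proof. exact: word_lin_mword. Qed.

Lemma word_map_comp h h' p : word_map h (word_map h' p) = word_map (h \o h') p.
Proof.
elim/mword_ind: p => [s|c p q IHp IHq]; first by rewrite !word_map_mword.
by rewrite !linearP /= IHp IHq.
Qed.

Lemma eq_word_map h h' (p : F) :
  {in msupp p, forall w : {fmonom 'I_n}, h w = h' w} ->
  word_map h p = word_map h' p.
Proof.
by move=> e; apply: eq_big_seq => w /e ->.
Qed.

Lemma word_map_homog h m m' p :
  (forall s, size s = m -> size (h s) = m') ->
  homog m p -> homog m' (word_map h p).
Proof.
move=> hm hp; rewrite /word_map /word_lin big_seq.
apply: (big_ind (homog m' : F -> Prop)) => [|x y hx hy|w /hp sw].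
- exact: homog0.
- by rewrite -[x]scale1r; apply: homogD.
- rewrite -(hm _ sw) -(mwordU _ (FMonom (h w))); exact: homogU.
Qed.

Lemma mcoeff_word_map h p w :
  (word_map h p)@_w = \sum_(v <- msupp p) p@_v *+ (FMonom (h v) == w).
Proof.
rewrite raddf_sum; apply: eq_bigr => v _ /=.
by rewrite mcoeffZ mcoeffU mulrnAr mulr1.
Qed.

End LinearExtension.

Arguments mword_cons {k n} i s.

Section Bilinearity.
Variables (k : fieldType) (n : nat).

Lemma mulDZl (B : lalgType k) (c : k) (x x' y : B) :
  (c *: x + x') * y = c *: (x * y) + x' * y.
Proof. by rewrite mulrDl -scalerAl. Qed.

Lemma mulDZr (B : algType k) (c : k) (x y y' : B) :
  x * (c *: y + y') = c *: (x * y) + x * y'.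
Proof. by rewrite mulrDr -scalerAr. Qed.

Lemma freealg_mulDZr (c : k) (p q q' : freealg k n) :
  p * (c *: q + q') = c *: (p * q) + p * q'.
Proof. by rewrite mulrDr -malg_scaleAr. Qed.

End Bilinearity.

Section UniversalProperty.
Variables (k : fieldType) (n : nat) (B : algType k) (b : 'I_n -> B).
Local Notation F := (freealg k n).

Definition free_lift : F -> B := word_lin (fun s => \prod_(i <- s) b i).

HB.instance Definition _ := GRing.Linear.on free_lift.

Lemma free_lift_mword s : free_lift (mword s) = \prod_(i <- s) b i.
Proof. exact: word_lin_mword. Qed.

Lemma free_lift_xgen i : free_lift (xgen i) = b i.
Proof. by rewrite free_lift_mword big_seq1. Qed.

Lemma free_lift_is_monoid_morphism : monoid_morphism free_lift.
Proof.
split=> [|p q]; first by rewrite -mword_nil free_lift_mword big_nil.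
elim/mword_ind: p => [s|c p p' IHp IHp']; last first.
  rewrite [_ * q]mulDZl [LHS]linearP [free_lift (_ + p')]linearP.
  by rewrite [RHS]mulDZl /= IHp IHp'.
elim/mword_ind: q => [t|c q q' IHq IHq']; last first.
  rewrite [mword s * _]freealg_mulDZr [LHS]linearP [free_lift (_ + q')]linearP.
  by rewrite [RHS]mulDZr /= IHq IHq'.
by rewrite -mword_cat !free_lift_mword big_cat.
Qed.

HB.instance Definition _ := GRing.isMonoidMorphism.Build F B free_lift
  free_lift_is_monoid_morphism.

(** The universal property of k<x_1, ..., x_n>/(S).  The lift is computed on
    representatives, which is harmless since it kills the ideal. *)
Lemma quadalg_lift (S : quadratic_rels k n) :
  (forall p, ideal S p -> free_lift p = 0) ->
  exists phi : {lrmorphism quadalg S -> B},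
    forall p, phi (quadpi S p) = free_lift p.
Proof.
move=> Sb; pose g (a : quadalg S) := free_lift (repr a).
have gE p : g (quadpi S p) = free_lift p.
  by apply/eqP; rewrite -subr_eq0 -linearB; apply/eqP/Sb/ideal_repr.
have g_lin : linear g.
  move=> c a a'; rewrite -[a]quadpiK -[a']quadpiK -linearP.
  by rewrite !gE linearP.
have g_mul : monoid_morphism g.
  split=> [|a a']; first by rewrite -(rmorph1 (quadpi S)) gE rmorph1.
  rewrite -[a]quadpiK -[a']quadpiK -rmorphM.
  by rewrite !gE rmorphM.
pose gL := GRing.isLinear.Build k (quadalg S) B *:%R g g_lin.
pose gM := GRing.isMonoidMorphism.Build (quadalg S) B g g_mul.
pose phi : {lrmorphism quadalg S -> B} := HB.pack g gL gM.
by exists phi.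
Qed.

End UniversalProperty.

(** * Normal forms of words *)

Section NormalForms.
Variables (n : nat) (z : 'I_n).
Implicit Types (s t u : seq 'I_n) (i j : 'I_n).

Definition nf s : seq 'I_n :=
  if s is x :: s' then rcons (nseq (size s') z) (last x s') else [::].

Lemma size_nf s : size (nf s) = size s.
Proof. by case: s => //= x s; rewrite size_rcons size_nseq. Qed.

Lemma last_nf x s : last x (nf s) = last x s.
Proof. by case: s => //= y s; rewrite last_rcons. Qed.

(** All the equalities between normal forms below follow from this one, by
    comparing lengths and last letters.  The default letter z lets the empty
    word have a last letter too. *)
Lemma eq_nf s t : size s = size t -> last z s = last z t -> nf s = nf t.
Proof. by case: s t => [|x s] [|y t] //= [->] ->. Qed.

Lemma nf_id s : nf (nf s) = nf s.
Proof. by apply: eq_nf; rewrite ?size_nf ?last_nf. Qed.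

Lemma nf_cat s t : nf (nf s ++ nf t) = nf (s ++ t).
Proof. by apply: eq_nf; rewrite ?size_cat ?size_nf // !last_cat !last_nf. Qed.

Lemma nf_rcons m j : nf (rcons (nseq m z) j) = rcons (nseq m z) j.
Proof.
case: m => //= m; rewrite last_rcons size_rcons size_nseq.
by [].
Qed.

(** The letters of a fixed word before its last one are all equal to z, so a
    word that is not fixed has another letter j there, with some letter p
    right after it. *)
Lemma nf_fixedP s : nf s != s <-> exists j p, j != z /\ infix [:: j; p] s.
Proof.
split=> [|[j [p [jz /infixP[a [c ->]]]]]].
  elim: s => [|x [|y s] IH]; rewrite ?eqxx //.
  have [->|xz _] := eqVneq x z; last first.
    by exists x, y; split=> //; apply/infixP; exists [::], s.
  have -> : nf [:: z, y & s] = z :: nf (y :: s) by [].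
  rewrite eqseq_cons eqxx => /IH[j [p [jz js]]]; exists j, p; split=> //.
  by apply: (infix_trans js); apply: (infix_catl [:: z]); apply: infix_refl.
apply: contra jz => /eqP/(congr1 (nth z ^~ (size a))).
rewrite [in RHS]nth_cat ltnn subnn /= => <-.
have: size (a ++ [:: j, p & c]) = (size a + (size c).+2)%N by rewrite size_cat.
case: (a ++ _) => [|x t] /=; first by rewrite addnS.
rewrite addnS => -[sE]; rewrite nth_rcons size_nseq nth_nseq sE.
by rewrite addnS ltnS leq_addr.
Qed.

Lemma nf_infix s u : infix u s -> nf s = s -> nf u = u.
Proof.
move=> us nfs; apply/eqP/contraT => /nf_fixedP[j [p [jz ju]]].
suff /eqP : nf s != s by [].
by apply/nf_fixedP; exists j, p; split=> //; apply: infix_trans us.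
Qed.

Lemma nf_fixed_size d s : (0 < d)%N -> size s = d /\ nf s = s <->
  exists j, s = rcons (nseq d.-1 z) j.
Proof.
move=> d_gt0; split=> [[]|[j ->]].
  case: s => [|x s] sd nfs; first by rewrite -sd in d_gt0.
  by exists (last x s); rewrite -[LHS]nfs -sd.
by rewrite nf_rcons size_rcons size_nseq prednK.
Qed.

Hypothesis z_min : forall i, (z <= i)%N.

Lemma lexle_cons x s y t :
  lexle (x :: s) (y :: t) = (x < y)%N || (x == y) && lexle s t.
Proof.
rewrite /lexle Order.SeqLexiOrder.lexi_cons /= !leEord.
rewrite -val_eqE /=; by case: ltngtP.
Qed.

(** The first letter of s that nf changes is replaced by the smallest letter. *)
Lemma deglexle_nf s : deglexle (nf s) s.
Proof.
rewrite /deglexle size_nf eqxx ltnn /=; case: s => // x s.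
elim: s x => [|y s IH] x /=; first by rewrite lexle_cons eqxx orbT.
by rewrite lexle_cons IH andbT orbC -val_eqE -leq_eqVlt z_min.
Qed.

Lemma deglexle_anti : antisymmetric (@deglexle n).
Proof.
move=> s t; rewrite /deglexle; case: ltngtP => //= _ /andP[st ts].
apply: (@Order.POrderTheory.le_anti _ (seqlexi (ordinal n))).
by apply/andP; split; [exact: st | exact: ts].
Qed.

Lemma lexle_rcons m i j :
  lexle (rcons (nseq m z) i) (rcons (nseq m z) j) = (i <= j)%N.
Proof.
elim: m => [|m IH] /=; last by rewrite lexle_cons ltnn eqxx IH.
rewrite lexle_cons [lexle _ _]Order.POrderTheory.lexx.
by rewrite andbT orbC -val_eqE -leq_eqVlt.
Qed.
End NormalForms.

(** * The ideal of relations as the kernel of a linear map *)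

Section Reduction.
Variables (k : fieldType) (n : nat) (z : 'I_n).
Local Notation F := (freealg k n).
Local Notation nf := (nf z).
Implicit Types (p q : F) (s t : seq 'I_n).

Definition reduce : F -> F := word_map nf.

HB.instance Definition _ := GRing.Linear.on reduce.

Lemma reduce_mword s : reduce (mword s) = mword (nf s).
Proof. exact: word_map_mword. Qed.

(** The hypothesis says that f comes from a congruence of the monoid of words;
    by bilinearity, it extends to all products. *)
Lemma linear_congr_mul (f : {linear F -> F}) :
  (forall s t, f (mword (s ++ t)) = f (f (mword s) * f (mword t))) ->
  forall p q, f (p * q) = f (f p * f q).
Proof.
move=> f_word p q.
elim/mword_ind: p => [s|c p p' IHp IHp']; last first.
  rewrite [_ * q]mulDZl [LHS]linearP [f (_ + p')]linearP.
  rewrite [RHS](congr1 f (mulDZl _ _ _ _)) [RHS]linearP.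
  exact: (congr2 (fun a b => c *: a + b) IHp IHp').
elim/mword_ind: q => [t|c q q' IHq IHq']; last first.
  rewrite [mword s * _]freealg_mulDZr [LHS]linearP [f (_ + q')]linearP.
  rewrite [RHS](congr1 f (freealg_mulDZr _ _ _ _)) [RHS]linearP.
  exact: (congr2 (fun a b => c *: a + b) IHq IHq').
by rewrite -mword_cat f_word.
Qed.

Lemma reduceM p q : reduce (p * q) = reduce (reduce p * reduce q).
Proof.
apply: linear_congr_mul => s t.
by rewrite /= !reduce_mword -mword_cat reduce_mword nf_cat.
Qed.

(** This makes the kernel of f a two-sided ideal. *)
Lemma congr_mul_kernel (R : nzRingType) (f : {additive R -> R}) :
  (forall u v, f (u * v) = f (f u * f v)) ->
  forall a u b, f u = 0 -> f (a * u * b) = 0.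
Proof.
by move=> fM a u b u0; rewrite fM [f (a * u)]fM u0 mulr0 raddf0 mul0r raddf0.
Qed.

Definition reduce_kernel : set F := [set p | reduce p = 0].

Lemma reduce_ideal_sub (S : set F) : S `<=` reduce_kernel ->
  ideal S `<=` reduce_kernel.
Proof.
move=> S0 _ [s [Ss ->]]; rewrite /reduce_kernel /= linear_sum big_seq.
apply: big1 => t /Ss/S0 /= t0.
exact: (congr_mul_kernel (f := reduce) reduceM).
Qed.

(** One step of the reduction of a word x y s: change its first letter x to v,
    and then its tail y s to u. *)
Lemma telescope_mul (R : nzRingType) (x y v s u : R) :
  (x * y - v * y) * s + v * (y * s - u) = x * (y * s) - v * u.
Proof. by rewrite mulrBl mulrBr !mulrA addrA subrK. Qed.

(** On a word x y s, with y s already reduced by induction, a single relation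
    replaces x by z. *)
Lemma sub_reduce_ideal (S : set F) :
  (forall x y, ideal S (xgen x * xgen y - xgen z * xgen y)) ->
  forall p, ideal S (p - reduce p).
Proof.
move=> Sxy.
elim/mword_ind => [s|c p q IHp IHq]; last first.
  rewrite [X in ideal S X](linearP (idfun \- reduce) c p q).
  by apply: idealD; [apply: idealZ; exact: IHp | exact: IHq].
rewrite reduce_mword; elim: s => [|x [|y s] IHs].
- by rewrite subrr; apply: ideal0.
- by rewrite subrr; apply: ideal0.
have -> : mword [:: x, y & s] - mword (nf [:: x, y & s]) =
    xgen x * (xgen y * mword s) - xgen z * mword (nf (y :: s)) :> F.
  by rewrite (mword_cons x (y :: s)) (mword_cons y s) [mword (nf _)]mword_cons.
rewrite -[X in ideal S X]telescope_mul; apply: idealD.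
  by apply: Defs.idealMr; exact: Sxy.
by apply: idealMl; rewrite (mword_cons y s) in IHs.
Qed.

Lemma ideal_reduce (S : set F) : S `<=` reduce_kernel ->
  (forall x y, ideal S (xgen x * xgen y - xgen z * xgen y)) ->
  ideal S = reduce_kernel.
Proof.
move=> S0 Sxy; apply/seteqP; split; first exact: reduce_ideal_sub.
by move=> p p0; have := sub_reduce_ideal Sxy p; rewrite p0 subr0.
Qed.

Lemma reduce_xgen2 x y : reduce (xgen x * xgen y) = mword [:: z; y].
Proof. by rewrite mword2 reduce_mword. Qed.

Lemma reduce_gen2 x v y :
  reduce_kernel (xgen x * xgen y - xgen v * xgen y).
Proof.
rewrite /reduce_kernel /= [LHS]linearB; apply/eqP; rewrite subr_eq0; apply/eqP.
exact: etrans (reduce_xgen2 x y) (esym (reduce_xgen2 v y)).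
Qed.

Lemma ideal_mem (S : set F) p : S p -> ideal S p.
Proof. by move=> /(ideal_gen 1 1); rewrite mul1r mulr1. Qed.

Lemma subr_common (V : zmodType) (u v w : V) : (u - w) - (v - w) = u - v.
Proof. by rewrite opprB addrA subrK. Qed.

(** The letter f y is only an intermediate value: both x y and z y are congruent
    to (f y) y. *)
Lemma YB_ideal (f : {perm 'I_n}) :
  ideal (YB_rels k (perm_idem_sol f)) = reduce_kernel.
Proof.
apply: ideal_reduce => [_ [x [y ->]]|x y]; first exact: reduce_gen2.
have gen u : ideal (YB_rels k (perm_idem_sol f))
    (xgen u * xgen y - xgen (f y) * xgen y).
  by apply: ideal_mem; exists u, y.
rewrite -[X in ideal _ X](subr_common _ _ (xgen (f y) * xgen y)).
by apply: Defs.idealB; apply: gen.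
Qed.

Lemma veronese_ideal : ideal (veronese_rels k z) = reduce_kernel.
Proof.
apply: ideal_reduce => [_ [j [p [_ ->]]]|x y]; first exact: reduce_gen2.
have [->|xz] := eqVneq x z; first by rewrite subrr; apply: ideal0.
by apply: ideal_mem; exists x, y.
Qed.

Hypothesis z_min : forall i : 'I_n, (z <= i)%N.

Lemma lead_word_uniq p u v : lead_word p u -> lead_word p v -> u = v.
Proof.
move=> [up pu] [vp pv]; apply: val_inj; apply: deglexle_anti.
by rewrite pu // pv.
Qed.

Lemma lead_word_binomial s t : s != t -> deglexle t s ->
  lead_word (mword s - mword t : F) (FMonom s).
Proof.
move=> st ts; split=> [|v]; rewrite -mcoeff_neq0 mcoeffB !mcoeffU ?eqxx.
  have -> : (FMonom t == FMonom s) = false.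
    by apply/negbTE; apply: contra st => /eqP[->].
  by rewrite subr0 oner_neq0.
(* The coefficient at v can only be nonzero for v = s or v = t. *)
have [<- _|sv] := eqVneq (FMonom s) v.
  by rewrite /deglexle ltnn eqxx /lexle Order.POrderTheory.lexx.
have [<- //|] := eqVneq (FMonom t) v.
by rewrite subr0 eqxx.
Qed.

(** If w were fixed by nf, the words of p reduced to w would be w itself and
    words larger than w.  There are none of the latter, so the coefficient of
    w in reduce p = 0 would be its nonzero coefficient in p. *)
Lemma lead_word_reducible p w : reduce p = 0 -> lead_word p w -> nf w != w.
Proof.
move=> p0 [wp pw]; apply: contraTneq wp => nfw.
rewrite -mcoeff_eq0; apply/eqP.
have <- : (reduce p)@_w = p@_w; last by rewrite p0 mcoeff0.
rewrite mcoeff_word_map [in RHS](monalgE p) raddf_sum /=.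
apply: eq_big_seq => v vp; rewrite mcoeffU; congr (_ *+ nat_of_bool _).
apply/eqP/eqP => [vw|->]; last by apply: val_inj; exact: nfw.
apply: val_inj; apply: deglexle_anti; rewrite pw //=.
by have := deglexle_nf z_min v; rewrite -[nf v]/(val (FMonom (nf v))) vw.
Qed.

(** A word s that is not fixed is the leading word of the element
    s - nf s of the ideal, hence it is not normal. *)
Lemma normal_wordE s : normal_word reduce_kernel s <-> nf s = s.
Proof.
split=> [|nfs p u p0 /(lead_word_reducible p0)]; last first.
  by apply: contra => us; apply/eqP; apply: nf_infix us nfs.
move=> snormal; apply/eqP; apply: contraT => nfs.
have /snormal/(_ (lead_word_binomial _ (deglexle_nf z_min s))) :
    reduce_kernel (mword s - mword (nf s)).
  by rewrite /reduce_kernel /= linearB /= !reduce_mword nf_id subrr.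
by rewrite eq_sym => /(_ nfs); rewrite infix_refl.
Qed.

Lemma rel_mword (j i : 'I_n) :
  xgen j * xgen i - xgen z * xgen i = mword [:: j; i] - mword [:: z; i] :> F.
Proof. exact: (congr2 (fun a b => a - b) (mword2 _ j i) (mword2 _ z i)). Qed.

Lemma lead_word_rel (j i : 'I_n) : j != z ->
  lead_word (xgen j * xgen i - xgen z * xgen i : F) (FMonom [:: j; i]).
Proof.
move=> jz; rewrite rel_mword; apply: lead_word_binomial.
  by rewrite eqseq_cons (negbTE jz).
rewrite /deglexle /= lexle_cons ltn_neqAle z_min andbT.
by rewrite eq_sym val_eqE jz.
Qed.

(** A leading word is not fixed by nf, hence has a factor x_j x_i with j <> z,
    and this factor is the leading word of a relation. *)
Lemma veronese_groebner :
  groebner_basis (ideal (veronese_rels k z)) (veronese_rels k z).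
Proof.
split=> // p w; rewrite veronese_ideal => p0 /(lead_word_reducible p0).
move=> /nf_fixedP[j [i [jz ji]]].
exists (xgen j * xgen i - xgen z * xgen i), (FMonom [:: j; i]); split=> //.
- by exists j, i.
- exact: lead_word_rel.
Qed.

Lemma veronese_rels_binomial : veronese_rels k z `<=` @is_binomial k n.
Proof.
move=> _ [j [i [jz ->]]]; exists [:: j; i], [:: z; i].
by rewrite rel_mword eqseq_cons (negbTE jz).
Qed.

(** A relation is determined by its leading word x_j x_i, so that there are as
    many relations as pairs (j, i) with j <> z. *)
Lemma card_veronese_rels :
  (qrels (veronese_rels k z) #= `I_(n * (n - 1)))%card.
Proof.
pose g (x : 'I_n * 'I_n) : F := xgen x.1 * xgen x.2 - xgen z * xgen x.2.
pose D : {fset 'I_n * 'I_n} := [fset x in [predX predC1 z & 'I_n]]%fset.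
have DE x : x \in D = (x.1 != z) by rewrite !inE andbT.
have -> : qrels (veronese_rels k z) = g @` [set` D].
  apply/seteqP; split=> [_ [j [i [jz ->]]]|_ [[j i]] /= + <-].
    by exists (j, i) => //=; rewrite DE.
  by rewrite DE => jz; exists j, i.
have g_inj : {in [set` D] &, injective g}.
  move=> [j i] [j' i']; rewrite !inE /= !DE => jz jz' gE.
  have := lead_word_rel i' jz'; rewrite -[X in lead_word X]gE.
  by move/(lead_word_uniq (lead_word_rel i jz)) => [-> ->].
rewrite (card_eql (inj_card_eq g_inj)); apply/card_eq_fsetP.
rewrite card_imfset //= -cardE.
by rewrite cardX cardC1 card_ord subn1 mulnC.
Qed.

End Reduction.

(** * Stretching and contracting words *)

Section Stretching.
Variables (n : nat) (z : 'I_n) (d : nat).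
Hypothesis d_gt0 : (0 < d)%N.
Implicit Types (s t : seq 'I_n) (i j : 'I_n).
Local Notation nf := (nf z).

Definition veronese_word j : seq 'I_n := rcons (nseq d.-1 z) j.

(** The normal form of the image of s under x_i |-> w_i. *)
Definition stretch s : seq 'I_n := nf (flatten [seq veronese_word i | i <- s]).

(** Cutting t from the left keeps its last letter, so this is the normal word
    of length size t / d with the same last letter as t. *)
Definition contract t : seq 'I_n := nf (drop (size t - size t %/ d) t).

Lemma size_flatten_veronese_word s :
  size (flatten [seq veronese_word i | i <- s]) = (size s * d)%N.
Proof.
elim: s => //= i s IH.
by rewrite size_cat IH size_rcons size_nseq prednK // mulSn.
Qed.

Lemma last_flatten_veronese_word x s :
  last x (flatten [seq veronese_word i | i <- s]) = last x s.
Proof. by elim: s x => //= i s IH x; rewrite last_cat last_rcons IH. Qed.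

Lemma size_stretch s : size (stretch s) = (size s * d)%N.
Proof. by rewrite size_nf size_flatten_veronese_word. Qed.

Lemma nf_stretch s : nf (stretch s) = stretch s.
Proof. exact: nf_id. Qed.

Lemma stretch_nf s : stretch (nf s) = stretch s.
Proof.
apply: eq_nf; first by rewrite !size_flatten_veronese_word size_nf.
by rewrite !last_flatten_veronese_word last_nf.
Qed.

Lemma size_contract t : size (contract t) = (size t %/ d)%N.
Proof. by rewrite size_nf size_drop subKn // leq_div. Qed.

Lemma last_contract t : (d %| size t)%N -> last z (contract t) = last z t.
Proof.
move=> dt; rewrite last_nf; case: (posnP (size t)) => [/size0nil -> //|t_gt0].
rewrite -[in RHS](cat_take_drop (size t - size t %/ d) t) last_cat.
case: (drop _ t) (size_drop (size t - size t %/ d) t) => //= /esym/eqP.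
by rewrite subKn ?leq_div // eqn0Ngt divn_gt0 // dvdn_leq.
Qed.

Lemma contract_stretch s : contract (stretch s) = nf s.
Proof.
rewrite -[contract _]nf_id; apply: eq_nf.
  by rewrite size_contract size_stretch mulnK.
rewrite last_contract ?size_stretch ?dvdn_mull // last_nf.
exact: last_flatten_veronese_word.
Qed.

Lemma stretch_contract t : (d %| size t)%N -> stretch (contract t) = nf t.
Proof.
move=> dt; apply: eq_nf.
  rewrite size_flatten_veronese_word.
  by rewrite size_contract divnK.
by rewrite last_flatten_veronese_word last_contract.
Qed.

End Stretching.

(** * The Veronese subalgebra *)

Section VeroneseIsomorphism.
Variables (k : fieldType) (n : nat) (z : 'I_n) (d : nat).
Hypothesis d_gt0 : (0 < d)%N.
Local Notation F := (freealg k n).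
Variable S : quadratic_rels k n.
Hypothesis S_ideal : ideal S = reduce_kernel z.
Local Notation V := (veronese (length_grading S) d).
Implicit Types (p q : F) (s t : seq 'I_n).

Lemma quadpi_kernel p : quadpi S p = 0 <-> reduce z p = 0.
Proof.
have -> : (reduce z p = 0) = ideal S (p - 0) by rewrite S_ideal subr0.
by rewrite -(raddf0 (quadpi S)); exact: quadpi_eq.
Qed.

Lemma reduce_id p : reduce z (reduce z p) = reduce z p.
Proof.
by rewrite /reduce word_map_comp; apply: eq_word_map => w _; apply: nf_id.
Qed.

Lemma reduce_homog1 p : homog 1 p -> reduce z p = p.
Proof.
move=> hp; rewrite [RHS]mwordE -[RHS]/(word_map id p); apply: eq_word_map.
by case=> -[|i [|j s]] /hp.
Qed.

Lemma quadpi_reduce p : quadpi S (reduce z p) = quadpi S p.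
Proof.
apply/eqP; rewrite -subr_eq0 -linearB; apply/eqP/quadpi_kernel.
by rewrite linearB /= reduce_id subrr.
Qed.

Lemma veronese_word_in j :
  quadpi S (mword (veronese_word z d j)) \in veronese_pred (length_grading S) d.
Proof.
apply/asboolP; apply: (@veronese_part _ _ _ _ 1); rewrite mul1n.
exists (mword (veronese_word z d j)) => //.
have sw : size (veronese_word z d j) = d by rewrite size_rcons size_nseq prednK.
by rewrite -[X in homog X]sw; apply: (homogU 1 (FMonom _)).
Qed.

Definition veronese_gen j : V := Veronese (veronese_word_in j).

Definition veronese_lift : F -> V := free_lift veronese_gen.

(** The lift sends a word to the concatenation of the words w_i, which has the
    same class as its normal form. *)
Lemma val_veronese_lift p :
  val (veronese_lift p) = quadpi S (word_map (stretch z d) p).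
Proof.
elim/mword_ind: p => [s|c p q IHp IHq]; last first.
  rewrite [veronese_lift _](linearP (free_lift veronese_gen)).
  rewrite [LHS](linearP (val : V -> _)).
  rewrite [word_map _ _]linearP [RHS]linearP.
  exact: (congr2 (fun a b => c *: a + b) IHp IHq).
rewrite word_map_mword -reduce_mword quadpi_reduce.
rewrite /veronese_lift free_lift_mword.
elim: s => [|i s IH]; first by rewrite big_nil mword_nil !rmorph1.
rewrite big_cons mword_cat [RHS]rmorphM [LHS]rmorphM.
exact: (congr1 ( *%R _) IH).
Qed.

(** This gives both the existence and the injectivity of the induced morphism:
    stretch only depends on nf s, and contract recovers nf s from stretch s. *)
Lemma veronese_lift_eq0 p : veronese_lift p = 0 <-> reduce z p = 0.
Proof.
have stretch_reduce :
    word_map (stretch z d) (reduce z p) = word_map (stretch z d) p.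
  by rewrite /reduce word_map_comp; apply: eq_word_map => w _; apply: stretch_nf.
split=> [p0|p0]; last first.
  by apply: val_inj; rewrite val_veronese_lift -stretch_reduce p0 !linear0.
have reduce_stretch :
    reduce z (word_map (stretch z d) p) = word_map (stretch z d) p.
  by rewrite /reduce word_map_comp; apply: eq_word_map => w _; apply: nf_stretch.
have contractK :
    word_map (contract z d) (word_map (stretch z d) p) = reduce z p.
  by rewrite word_map_comp; apply: eq_word_map => w _; apply: contract_stretch.
have : quadpi S (word_map (stretch z d) p) = 0.
  by rewrite -val_veronese_lift p0 linear0.
rewrite -contractK => /quadpi_kernel; rewrite reduce_stretch => ->.
by rewrite linear0.
Qed.

Lemma veronese_lift_homog m p : homog m p ->
  veronese_gpart (d := d) (G := length_grading S) m (veronese_lift p).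
Proof.
move=> hp; exists (word_map (stretch z d) p); last by rewrite val_veronese_lift.
by apply: word_map_homog hp => s <-; apply: size_stretch.
Qed.

(** If q has degree m * d, then stretching back the contraction of q gives the
    reduction of q, which has the same class as q. *)
Lemma veronese_lift_gpart_surj m (a : V) :
  veronese_gpart m a -> exists2 p, homog m p & veronese_lift p = a.
Proof.
move=> [q hq qa]; exists (word_map (contract z d) q).
  by apply: word_map_homog hq => s sm; rewrite size_contract // sm mulnK.
apply: val_inj; rewrite val_veronese_lift word_map_comp -qa -(quadpi_reduce q).
apply: (congr1 (quadpi S)); apply: eq_word_map => w /hq sw /=.
by rewrite stretch_contract // sw dvdn_mull.
Qed.

Lemma veronese_lift_surj (a : V) : exists p, veronese_lift p = a.
Proof.
have /asboolP[N [c [Gc ac]]] := veroneseP a.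
have cV m : c m \in veronese_pred (length_grading S) d.
  by apply/asboolP; apply: veronese_part (Gc m).
have /choice[p pE] : forall m, exists p, veronese_lift p = Veronese (cV m).
  move=> m; have [p] := @veronese_lift_gpart_surj m (Veronese (cV m)) (Gc m).
  by exists p.
exists (\sum_(m < N) p m); apply: val_inj.
rewrite [veronese_lift _](linear_sum (free_lift veronese_gen)).
rewrite [LHS](raddf_sum (val : V -> _)) [RHS]ac.
by apply: eq_bigr => m _; exact: (congr1 val (pE m)).
Qed.

(** The source S' may differ from the relations S of the algebra whose Veronese
    subalgebra is taken; only their ideals have to agree. *)
Lemma veronese_presentation (S' : quadratic_rels k n) :
  ideal S' = reduce_kernel z ->
  presentation S' (veronese_gpart (d := d) (G := length_grading S))
    veronese_gen.
Proof.
move=> S'_ideal; have S'0 p : ideal S' p -> veronese_lift p = 0.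
  by rewrite S'_ideal => /veronese_lift_eq0.
have [phi phiE] := quadalg_lift S'0; exists phi.
have phi_inj : injective phi.
  apply: raddf_inj => a a0; have : phi a = 0 by [].
  rewrite -[a]quadpiK phiE => /veronese_lift_eq0 {}a0.
  rewrite -(raddf0 (quadpi S')); apply/quadpi_eq.
  by rewrite S'_ideal subr0.
split.
- have /choice[g gK] : forall a, exists b, phi b = a.
    move=> a; have [p <-] := veronese_lift_surj a.
    by exists (quadpi S' p); apply: phiE.
  by exists g => // a; apply: phi_inj.
- by move=> i; rewrite phiE; apply: free_lift_xgen.
- move=> m a; split=> [[p hp <-]|/veronese_lift_gpart_surj[p hp]].
    by rewrite phiE; apply: veronese_lift_homog.
  by move/(etrans (phiE p))/phi_inj <-; exists p.
Qed.

(** The component of degree 1 of the Veronese subalgebra is the image of the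
    homogeneous elements of degree 1, on which reduce is the identity; hence
    no linear relation holds between the generators. *)
Lemma veronese_one_generators :
  one_generators (veronese_gpart (d := d) (G := length_grading S)) veronese_gen.
Proof.
have veronese_lift_comb (c : {ffun 'I_n -> k}) :
    veronese_lift (\sum_i c i *: xgen i) = \sum_i c i *: veronese_gen i.
  rewrite [LHS](linear_sum (free_lift veronese_gen)); apply: eq_bigr => i _.
  by rewrite linearZ /= free_lift_xgen.
have mcoeff_comb (c : {ffun 'I_n -> k}) j :
    (\sum_i c i *: xgen i : F)@_(FMonom [:: j]) = c j.
  rewrite raddf_sum (bigD1 j) //= big1 => [|i ij].
    by rewrite mcoeffZ mcoeffUU mulr1 addr0.
  by rewrite mcoeffZ mcoeffU fmP /= eqseq_cons (negbTE ij) mulr0.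
have homog_comb (c : {ffun 'I_n -> k}) : homog 1 (\sum_i c i *: xgen i : F).
  apply: (big_ind (homog 1 : F -> Prop)) => [|x y hx hy|i _].
  - exact: homog0.
  - by rewrite -[x]scale1r; apply: homogD.
  - by rewrite -(mwordU _ (FMonom [:: i])); apply: homogU.
split.
- apply/seteqP; split=> [a /veronese_lift_gpart_surj[p hp <-]|_ [c _ <-]]; last first.
    by rewrite -veronese_lift_comb; apply: veronese_lift_homog.
  exists [ffun i => p@_(FMonom [:: i])] => //; rewrite -veronese_lift_comb.
  congr (veronese_lift _); apply/malgP => w.
  have [sw|sw] := eqVneq (size w) 1%N; last first.
    move/homogP/(_ w sw): hp => ->.
    by move/homogP/(_ w sw): (homog_comb [ffun i => p@_(FMonom [:: i])]) => ->.
  case: w sw => [[|i []]] //= _.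
  by rewrite mcoeff_comb ffunE.
- move=> c c' /=; rewrite -!veronese_lift_comb => /eqP; rewrite -subr_eq0 -linearB.
  move=> /eqP/veronese_lift_eq0; rewrite reduce_homog1 => [e|]; last first.
    by rewrite addrC -scaleN1r; apply: homogD; apply: homog_comb.
  apply/ffunP => j; apply/eqP; rewrite -subr_eq0 -!mcoeff_comb -mcoeffB e.
  by rewrite mcoeff0.
- move=> W [W1 WL WM] Wb a; have [p <-] := veronese_lift_surj a.
  elim/mword_ind: p => [s|c p q Wp Wq].
    by rewrite /veronese_lift free_lift_mword; apply: (big_ind [in W]).
  by rewrite [veronese_lift _](linearP (free_lift veronese_gen)); apply: WL.
Qed.

End VeroneseIsomorphism.

Theorem theorem6p12 (k : fieldType) (n : nat) (hn : (1 < n)%N)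
    (f : {perm 'I_n}) (d : nat) (hd : (1 < d)%N) :
  let r := perm_idem_sol f in
  let A := YB_algebra k r in
  let G := YB_grading k r in
  let x1 : 'I_n := Ordinal (ltnW hn) in
  let w (j : 'I_n) : seq 'I_n := rcons (nseq d.-1 x1) j in
  (* N_d *)
  [/\ forall s, (size s = d /\ normal_word (ideal (YB_rels k r)) s) <->
                exists j, s = w j,
      {mono w : i j / (i <= j)%N >-> lexle i j},
  (* (1) *)
      exists wd : 'I_n -> veronese G d,
        [/\ forall j, val (wd j) = quadpi (YB_rels k r) (mword (w j)),
            one_generators (veronese_gpart (d := d)) wd,
            PBW_algebra (veronese_gpart (d := d)) wd,
            presentation (veronese_rels k x1) (veronese_gpart (d := d)) wd &
            [/\ (qrels (veronese_rels k x1) #= `I_(n * (n - 1)))%card,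
                veronese_rels k x1 `<=` @is_binomial k n &
                groebner_basis (ideal (veronese_rels k x1)) (veronese_rels k x1)]]
  (* (2) *)
    & exists phi : {lrmorphism A -> veronese G d}, bijective phi].
Proof.
move=> r A G x1 w.
have x1_min (i : 'I_n) : (x1 <= i)%N by [].
have d_gt0 : (0 < d)%N by apply: ltnW.
have YB_kernel : ideal (YB_rels k r) = reduce_kernel x1 by exact: YB_ideal.
have pres := veronese_presentation d_gt0 YB_kernel (veronese_ideal k x1).
split.
- move=> s; rewrite YB_kernel -(nf_fixed_size x1 s d_gt0).
  by split=> -[sd] /(normal_wordE k x1_min).
- by move=> i j; apply: lexle_rcons.
- exists (veronese_gen x1 d_gt0 (YB_rels k r)); split=> //.
  + exact: veronese_one_generators.
  + by exists (veronese_rels k x1); split=> //; exact: veronese_groebner.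
  + split; first exact: card_veronese_rels.
      exact: veronese_rels_binomial.
    exact: veronese_groebner.
- have [phi [phi_bij _ _]] := veronese_presentation d_gt0 YB_kernel YB_kernel.
  by exists phi.
Qed.
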